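(* Let $a(1) = 1$ and $a(n) = a(\lfloor n/2 \rfloor) + \lfloor n/2 \rfloor$ for $n \ge 2$, and let $S(n) = \sum_{i=1}^{n} a(i)$ for $n \ge 0$ (so $S(0) = 0$). Then $S(n) \equiv 1 - m(n) \pmod 2$ for all $n \ge 0$.
   Context: For a non-negative integer $k$, $s_2(k)$ denotes the number of ones in the binary expansion of $k$. Define $\bar{t}(k) = 1$ if $s_2(k)$ is even and $\bar{t}(k)=0$ if $s_2(k)$ is odd. The sequence $m(n)$, $n \ge 0$, is defined by $m(2k) = \bar{t}(k)$ and $m(2k+1) = 0$ for all $k \ge 0$. The sequence $a$ is OEIS A113474 ($1,2,2,4,4,5,5,8,\ldots$, from $n=1$) and $S$ is OEIS A122248, indexed from $n=0$: $0,1,3,5,9,13,18,23,31,\ldots$. *)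

(* Defs.v *)
From mathcomp Require Import all_boot.

Set Implicit Arguments.
Unset Strict Implicit.
Unset Printing Implicit Defensive.

(* The i-th binary digit of k is odd (k %/ 2 ^ i); it is zero for i >= k since
   k < 2 ^ k, so all the ones of k are at positions i < k. *)
Definition s2 (k : nat) : nat := #|[set i : 'I_k | odd (k %/ 2 ^ i)]|.

Definition tbar (k : nat) : nat := if odd (s2 k) then 0 else 1.

(* m n is 0 or 1, so the truncated difference 1 - m n is the integer one. *)
Definition m (n : nat) : nat := if odd n then 0 else tbar n./2.

(* The two equations determine a at every n >= 1; the value a 0 is
   unconstrained. *)
Definition halving_rec (a : nat -> nat) : Prop :=
  a 1 = 1 /\ forall n, 2 <= n -> a n = a (n %/ 2) + n %/ 2.

Definition S_sum (a : nat -> nat) (n : nat) : nat := \sum_(1 <= i < n.+1) a i.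

(* Main.v *)
Require Import Defs.
From mathcomp Require Import all_boot.

(* In closed form a(n) = n + 1 - s_2(n) for n >= 1, so a(2k) has the parity
    of 1 - s_2(k). Since a(2k) = a(2k+1) for k >= 1, the sum S(2k+1) is a(1) = 1
    plus an even number, and S(2k+2) = S(2k+1) + a(2k+2) has the parity of
    s_2(k+1). *)

(** A range of positions that does not depend on [k] lets the digits of [n] and [n./2] be matched by
    a shift. *)
Lemma s2_sum k N : k <= N -> s2 k = \sum_(i < N) odd (k %/ 2 ^ i).
Proof.
move=> le_kN; rewrite /s2 cardsE -sum1_card big_mkcond /=.
rewrite (big_ord_widen N (fun i => if odd (k %/ 2 ^ i) then 1 else 0)) //.
rewrite big_mkcond; apply: eq_bigr => i _; case: ltnP => [_|le_ki]; first by case: odd.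
by rewrite divn_small // (leq_ltn_trans le_ki) // ltn_expl.
Qed.

Lemma s2_half n : s2 n = odd n + s2 n./2.
Proof.
rewrite (@s2_sum n n.+1) // big_ord_recl divn1; congr (_ + _).
rewrite (@s2_sum n./2 n); last by rewrite leq_half_double -addnn leqW // leq_addr.
by apply: eq_bigr => i _; rewrite expnS divnMA divn2.
Qed.

Lemma s2_double n : s2 n.*2 = s2 n.
Proof. by rewrite s2_half odd_double doubleK. Qed.

(** Stated additively to avoid truncated subtraction. In the induction step, the last digit [odd n]
    and two copies of [n./2] reassemble into [n]. *)
Lemma halving_rec_s2 (a : nat -> nat) (ha : halving_rec a) n :
  0 < n -> a n + s2 n = n.+1.
Proof.
case: ha => a1 aS; elim/ltn_ind: n => n IH n_gt0.
have [n_gt1|n_le1] := ltnP 1 n; last first.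
  have -> : n = 1 by apply/eqP; rewrite eqn_leq n_le1.
  by rewrite a1 (@s2_sum 1 1) // big_ord1.
have h_gt0 : 0 < n./2 by rewrite half_gt0.
have h_lt : n./2 < n by rewrite ltn_half_double -addnn -{1}[n]addn0 ltn_add2l.
rewrite aS // divn2 s2_half (addnC (odd n)) addnACA IH // addSn.
by rewrite addnA addnn addnC odd_double_half.
Qed.

Lemma halving_rec_doubleS (a : nat -> nat) (ha : halving_rec a) k :
  0 < k -> a k.*2.+1 = a k.*2.
Proof.
case: ha => _ aS; case: k => // k _.
by rewrite (aS k.+1.*2.+1) // (aS k.+1.*2) // !divn2 /= uphalf_double doubleK.
Qed.

Lemma S_sumS (a : nat -> nat) n : S_sum a n.+1 = S_sum a n + a n.+1.
Proof. by rewrite /S_sum big_nat_recr. Qed.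

Lemma odd_S_sum_doubleS (a : nat -> nat) (ha : halving_rec a) k :
  odd (S_sum a k.*2.+1).
Proof.
elim: k => [|k IH]; first by rewrite /S_sum big_nat1; case: ha => ->.
rewrite S_sumS halving_rec_doubleS // doubleS S_sumS !oddD IH.
by rewrite -addbA addbb.
Qed.

Theorem lemma11 (a : nat -> nat) (ha : halving_rec a) (n : nat) :
  S_sum a n = 1 - m n %[mod 2].
Proof.
rewrite !modn2; congr nat_of_bool.
rewrite -(odd_double_half n); case: (odd n); rewrite /m /= odd_double.
  exact: odd_S_sum_doubleS.
rewrite add0n doubleK; case: n./2 => [|k].
  (* At index 0 the sum is empty and [tbar 0] is 1, as ['I_0] has no elements. *)
  by rewrite /S_sum big_geq // /tbar /s2 cardsE eq_card0 // => -[].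
rewrite doubleS S_sumS oddD odd_S_sum_doubleS // -doubleS.
(* The right-hand side [k.+1.*2.+1] is odd, so [a] and [s2] have opposite parities at [k.+1.*2]. *)
have /(congr1 odd) := @halving_rec_s2 a ha k.+1.*2 isT.
rewrite oddD s2_double /= odd_double /tbar.
by case: odd; case: odd.
Qed.
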